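(* Let $F(\Lambda)=\{f_\lambda:\lambda\in\Lambda\}$ be a finite set of functions of cardinality $M=|\Lambda|$, and assume that for any $f\in F(\Lambda)$ we have $\|f-f_0\|_\infty\le Q$, for some $Q>0$. Let $T>0$ and let $\hat{\mathsf f}$ be the aggregate $$\hat{\mathsf f}:=\sum_{\lambda\in\Lambda}\theta(f_\lambda)f_\lambda,\qquad \theta(f):=\frac{\exp(-nR_n(f)/T)}{\sum_{\lambda\in\Lambda}\exp(-nR_n(f_\lambda)/T)} .$$ Then for any $a>0$, $$E^n\|\hat{\mathsf f}-f_0\|^2\le(1+a)\min_{f\in F(\Lambda)}\|f-f_0\|^2+(C+T)\frac{(\log n)^{1/2}\log M}{n},$$ where $C$ is a constant depending on $a$, $Q$ and $\sigma$ (the subgaussianity constant $b_\varepsilon$ of the model being fixed).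
   Context: Regression model: $(X,Y),(X_1,Y_1),\dots,(X_n,Y_n)$ are i.i.d. in $\mathbb R^d\times\mathbb R$ with $Y=f_0(X)+\sigma\varepsilon$, where $f_0:\mathbb R^d\to\mathbb R$, the noise level $\sigma>0$ is known, and $X$ takes values in $[0,1]^d$; its law $P_X$ is otherwise arbitrary. Conditionally on $X$, the noise $\varepsilon$ is symmetric and subgaussian: there is $b_\varepsilon>0$ with $E[\exp(t\varepsilon)\mid X]\le\exp(b_\varepsilon^2t^2/2)$ for all $t>0$. Notation: $E^n$ is expectation with respect to the joint law of the sample $(X_i,Y_i)_{1\le i\le n}$; $R_n(f):=\frac1n\sum_{i=1}^n(Y_i-f(X_i))^2$ is the empirical risk; $\|f\|^2:=\int f(x)^2P_X(dx)$; $\|f\|_\infty:=\sup_{x\in[0,1]^d}|f(x)|$. The functions in $F(\Lambda)$ are arbitrary fixed functions (not depending on the sample).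
   Formalization: The sample size is assumed to satisfy n ≥ 2; for n = 1 the residual term vanishes (log 1 = 0) and the inequality fails, e.g. for f_0 = 0 and F(Λ) = {0, Q}, where the right side is 0 but the aggregate has positive risk. *)

(* Defs.v *)
From HB Require Import structures.
From mathcomp Require Import all_boot all_order all_algebra.
From mathcomp Require Import all_classical all_reals all_analysis.
From mathcomp Require Import measurable_realfun.

Set Implicit Arguments.
Unset Strict Implicit.
Unset Printing Implicit Defensive.

Import Order.TTheory GRing.Theory Num.Theory.
Import numFieldNormedType.Exports.

Local Open Scope classical_set_scope.
Local Open Scope ring_scope.

(* R^d is [d.-tuple R], whose sigma-algebra is the one generated by the
   coordinate maps. *)

Definition unit_cube (R : realType) (d : nat) : set (d.-tuple R) :=
  [set x | forall i : 'I_d, 0 <= tnth x i <= 1].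

Definition supnorm (R : realType) (d : nat) (g : d.-tuple R -> R) : \bar R :=
  ereal_sup [set `|g x|%:E | x in unit_cube (R := R) (d := d)].

Definition sqnormL2 (R : realType) (disp : measure_display)
    (S : measurableType disp) (mu : {measure set S -> \bar R})
    (g : S -> R) : \bar R :=
  (\int[mu]_x ((g x) ^+ 2)%:E)%E.

Section Probability.
Context (R : realType) (disp disp' : measure_display)
  (Omega : measurableType disp) (S : measurableType disp')
  (P : probability Omega R).

Definition mutually_independent (I : finType) (Z : I -> Omega -> S) : Prop :=
  forall (J : {set I}) (A : I -> set S), (forall i, measurable (A i)) ->
    P (\bigcap_(i in [set` J]) Z i @^-1` A i) =
    (\big[*%E/1%E]_(i in J) P (Z i @^-1` A i))%E.

Definition identically_distributed (I : finType) (Z : I -> Omega -> S) : Prop :=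
  forall (i j : I) (A : set S), measurable A ->
    P (Z i @^-1` A) = P (Z j @^-1` A).

Definition iid (I : finType) (Z : I -> Omega -> S) : Prop :=
  mutually_independent Z /\ identically_distributed Z.

(* For a nonnegative [Z], [g \o X] is a version of E[Z | X], that is,
   g x = E[Z | X = x]; it exists and is unique up to P_X-null sets.  Infinite
   values are allowed, so Z need not be assumed integrable. *)
Definition is_cond_expectation (X : {RV P >-> S}) (Z : Omega -> \bar R)
    (g : S -> \bar R) : Prop :=
  [/\ measurable_fun setT g,
      (forall x, (0 <= g x)%E) &
      forall B : set S, measurable B ->
        (\int[P]_(w in X @^-1` B) Z w =
         \int[distribution P X]_(x in B) g x)%E].

(* For every Borel set B, the conditional probabilities P(eps \in B | X) and
   P(- eps \in B | X) coincide almost surely, i.e. have a common version. *)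
Definition cond_symmetric (X : {RV P >-> S}) (eps : {RV P >-> R}) : Prop :=
  forall B : set R, measurable B ->
    exists g : S -> \bar R,
      is_cond_expectation X (fun w => (\1_B (eps w))%:E) g /\
      is_cond_expectation X (fun w => (\1_B (- eps w))%:E) g.

Definition cond_subgaussian (b : R) (X : {RV P >-> S}) (eps : {RV P >-> R}) :
    Prop :=
  forall t : R, 0 < t ->
    exists2 g : S -> \bar R,
      is_cond_expectation X (fun w => (expR (t * eps w))%:E) g &
      {ae distribution P X,
        forall x, (g x <= (expR (b ^+ 2 * t ^+ 2 / 2))%:E)%E}.

End Probability.

(* [(X, Y)] is the generic pair, [(Xs i, Ys i)] the observations; the index
   [None] below stands for the generic pair. *)
Record regression_model (R : realType) (d n : nat) (disp : measure_display)
    (Omega : measurableType disp) (P : probability Omega R)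
    (f0 : d.-tuple R -> R) (sigma b : R)
    (X : {RV P >-> d.-tuple R}) (Y eps : {RV P >-> R})
    (Xs : 'I_n -> {RV P >-> d.-tuple R}) (Ys : 'I_n -> {RV P >-> R}) : Prop :=
  RegressionModel {
    model_iid : iid P (fun (i : option 'I_n) (w : Omega) =>
      if i is Some j then (Xs j w, Ys j w) else (X w, Y w));
    model_f0 : measurable_fun setT f0;
    model_eq : {ae P, forall w, Y w = f0 (X w) + sigma * eps w};
    model_cube : {ae P, forall w, unit_cube (X w)};
    model_symmetric : cond_symmetric X eps;
    model_subgaussian : cond_subgaussian b X eps
  }.

Section Aggregate.
Context (R : realType) (d n : nat) (L : finType) (f : L -> d.-tuple R -> R)
  (temp : R) (xs : 'I_n -> d.-tuple R) (ys : 'I_n -> R).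

Definition empirical_risk (g : d.-tuple R -> R) : R :=
  n%:R^-1 * \sum_(i < n) (ys i - g (xs i)) ^+ 2.

Definition agg_weight (g : d.-tuple R -> R) : R :=
  expR (- (n%:R * empirical_risk g) / temp) /
  \sum_(l : L) expR (- (n%:R * empirical_risk (f l)) / temp).

Definition aggregate (x : d.-tuple R) : R :=
  \sum_(l : L) agg_weight (f l) * f l x.

End Aggregate.

(* Main.v *)
(* Write g = f_lambda - f_0 and, for an observation, let
   Z(g) = (Y - f_lambda(X))^2 - (Y - f_0(X))^2
        = g(X)^2 - 2 sigma eps g(X),
   whose empirical mean L_n(g) differs from R_n(f_lambda) by a quantity that
   does not depend on lambda.  The exponential weights theta are the Gibbs
   weights, so that sum theta L_n(g) <= L_n(g') + T log M / n for every
   competitor g', while ||f_hat - f_0||^2 <= sum theta ||g||^2 by convexity.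
   Hence, with A = 1 + alpha,
     ||f_hat - f_0||^2 <= A (L_n(g') + T log M / n)
                          + max_lambda (||g||^2 - A L_n(g)).
   For c small, E exp(c (||g||^2 - A Z(g))) <= 1: the symmetric subgaussian
   noise costs a factor 1 + O(c^2) g(X)^2, which the part alpha g(X)^2 absorbs.
   By independence the maximum therefore has expectation at most log M / (c n),
   without truncating the noise.  The factor A in front of T is at most
   (log n)^(1/2) as soon as n >= exp(A^2); for smaller n the constant C absorbs
   the trivial bound Q^2. *)

Require Import Defs.
From HB Require Import structures.
From mathcomp Require Import all_boot all_order all_algebra.
From mathcomp Require Import all_classical all_reals all_analysis.
From mathcomp Require Import measurable_realfun.
From mathcomp Require Import ring lra.
Import Order.TTheory GRing.Theory Num.Theory.
Import numFieldNormedType.Exports.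
Local Open Scope classical_set_scope.
Local Open Scope ring_scope.

Set Implicit Arguments.
Unset Strict Implicit.
Unset Printing Implicit Defensive.

(** * Nonnegative integrals and independence *)

Section Integration.
Import HBNNSimple.
Context (R : realType) (disp : measure_display) (T : measurableType disp)
  (mu : {measure set T -> \bar R}).

(* Unlike [ge0_le_integral], no measurability is required. *)
Lemma ge0_le_integral_nonmeasurable (f g : T -> \bar R) :
  (forall x, 0 <= f x)%E -> (forall x, f x <= g x)%E ->
  (\int[mu]_x f x <= \int[mu]_x g x)%E.
Proof.
move=> f0 fg; have g0 x : (0 <= g x)%E by exact: le_trans (fg x).
rewrite !ge0_integralTE//; apply: le_ereal_sup => _ [h hf <-].
by exists h => // x; exact: le_trans (fg x).
Qed.

(** [h] is decomposed along its finitely many level sets. The case [W = 1] has the same shape, which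
    makes both sides of the next bound comparable term by term. *)
Lemma integral_nnsfun_comp_mul disp' (S : measurableType disp')
    (Phi : T -> S) (W : T -> R) (h : {nnsfun S >-> R}) :
  measurable_fun setT Phi -> measurable_fun setT W -> (forall x, 0 <= W x) ->
  (\int[mu]_x (h (Phi x) * W x)%:E =
   \sum_(r \in range h)
     r%:E * \int[mu]_(x in Phi @^-1` (h @^-1` [set r])) (W x)%:E)%E.
Proof.
move=> mPhi mW W0.
have ind0 r x : 0 <= r * \1_(h @^-1` [set r]) (Phi x) :> R.
  by have := nnfun_muleindic_ge0 h r (Phi x); rewrite -EFinM lee_fin.
have m1 r : measurable_fun setT (fun x => \1_(h @^-1` [set r]) (Phi x) : R).
  by apply: measurableT_comp => //; exact: measurable_indic.
transitivity (\int[mu]_x (\sum_(r \in range h)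
    (r * \1_(h @^-1` [set r]) (Phi x) * W x)%:E)%E)%E.
  apply: eq_integral => x _; rewrite [in LHS]fimfunE EFinM -fsumEFin//.
  by rewrite ge0_mule_fsuml// => r; rewrite lee_fin.
rewrite ge0_integral_fsum//; last 2 first.
- by move=> r; apply/measurable_EFinP; do 2 apply: measurable_funM => //.
- by move=> r x _; rewrite lee_fin mulr_ge0.
apply: eq_fsbigr => _ /set_mem[y _ <-].
under eq_integral do rewrite -mulrA EFinM.
rewrite ge0_integralZl_EFin//.
- congr (_ * _)%E; rewrite [RHS]integral_mkcond epatch_indic.
  by apply: eq_integral => x _; rewrite EFinM muleC.
- by move=> x _; rewrite lee_fin mulr_ge0.
- by apply/measurable_EFinP; apply: measurable_funM.
Qed.

(** The assumption on sets [B], which says that [k] bounds the conditional expectation of [W] given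
    [Phi], is the claim for indicators. It extends to simple functions by linearity and to [h] by
    monotone convergence. Independence and the subgaussian bound both pass through this lemma. *)
Lemma ge0_integral_comp_mul_le disp' (S : measurableType disp')
    (Phi : T -> S) (W : T -> R) (k : R) (h : S -> R) :
  measurable_fun setT Phi -> measurable_fun setT W ->
  (forall x, 0 <= W x) -> 0 <= k ->
  (forall B, measurable B ->
     \int[mu]_(x in Phi @^-1` B) (W x)%:E <= k%:E * mu (Phi @^-1` B))%E ->
  measurable_fun setT h -> (forall y, 0 <= h y) ->
  (\int[mu]_x (h (Phi x) * W x)%:E <= k%:E * \int[mu]_x (h (Phi x))%:E)%E.
Proof.
move=> mPhi mW W0 k0 kW mh h0.
have mh' : measurable_fun setT (EFin \o h) by exact/measurable_EFinP.
pose h_ := nnsfun_approx measurableT mh'.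
have mPhiB B : measurable B -> measurable (Phi @^-1` B).
  by move=> mB; rewrite -[_ @^-1` _]setTI; exact: mPhi.
have mhPhi n : measurable_fun setT (h_ n \o Phi).
  by apply: measurableT_comp => //; exact: measurable_funP.
have h_h n y : h_ n y <= h y.
  rewrite nnsfun_approxE -lee_fin.
  exact: (@le_approx _ _ _ _ (EFin \o h) n y (fun x _ => h0 x)).
have step n : (\int[mu]_x (h_ n (Phi x) * W x)%:E <=
    k%:E * \int[mu]_x (h (Phi x))%:E)%E.
  apply: (@le_trans _ _ (k%:E * \int[mu]_x (h_ n (Phi x) * 1)%:E)%E).
    rewrite !integral_nnsfun_comp_mul// ge0_mule_fsumr; last first.
      (* Distributing [k] requires every term to be nonnegative; for negative [r] the level set is
         empty. *)
      move=> r; have [r0|r0] := leP 0 r.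
        by rewrite mule_ge0// ?lee_fin// integral_ge0.
      by rewrite preimage_nnfun0// preimage_set0 integral_set0 mule0.
    apply: lee_fsum => // _ [y _ <-]; rewrite muleCA.
    apply: lee_wpmul2l; first by rewrite lee_fin.
    rewrite integral_cst ?mul1e//; last exact: mPhiB.
    exact: kW.
  apply: lee_wpmul2l; first by rewrite lee_fin.
  apply: ge0_le_integral => //.
  - by move=> x _; rewrite mulr1 lee_fin.
  - by under eq_fun do rewrite mulr1; apply/measurable_EFinP; exact: mhPhi.
  - by apply/measurable_EFinP; exact: measurableT_comp.
  - by move=> x _; rewrite mulr1 lee_fin.
have -> : (\int[mu]_x (h (Phi x) * W x)%:E =
    limn (fun n => \int[mu]_x (h_ n (Phi x) * W x)%:E))%E.
  rewrite -monotone_convergence//.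
  - apply: eq_integral => x _; apply/esym/cvg_lim => //.
    under eq_fun do rewrite EFinM.
    rewrite EFinM; apply: cvgeZr => //.
    apply: (cvg_nnsfun_approx measurableT mh' _ (x := Phi x)) => // y _.
    exact: h0.
  - by move=> n; apply/measurable_EFinP/measurable_funM => //; exact: mhPhi.
  - by move=> n x _; rewrite lee_fin mulr_ge0.
  - move=> x _ a b ab; rewrite lee_fin ler_wpM2r//.
    exact/lefP/nd_nnsfun_approx.
apply: lime_le; last exact: nearW.
apply: ereal_nondecreasing_is_cvgn => a b ab; apply: ge0_le_integral => //.
- by move=> x _; rewrite lee_fin mulr_ge0.
- by apply/measurable_EFinP/measurable_funM => //; exact: mhPhi.
- by apply/measurable_EFinP/measurable_funM => //; exact: mhPhi.
- by move=> x _; rewrite lee_fin ler_wpM2r//; exact/lefP/nd_nnsfun_approx.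
Qed.

End Integration.

Section Independence.
Context (R : realType) (disp disp' : measure_display)
  (Omega : measurableType disp) (S : measurableType disp')
  (P : probability Omega R) (I : finType) (Z : I -> Omega -> S).

(** Independence is given for events only. The passage to functions applies
    [ge0_integral_comp_mul_le] once per index, with the product of the other factors as the weight
    [W]. *)
Lemma le_expectation_prod_independent (h : I -> S -> R) (c : I -> R) :
  (forall i, measurable_fun setT (Z i)) -> mutually_independent P Z ->
  (forall i, measurable_fun setT (h i)) -> (forall i x, 0 <= h i x) ->
  (forall i, \int[P]_w (h i (Z i w))%:E <= (c i)%:E)%E ->
  (\int[P]_w (\prod_i h i (Z i w))%:E <= (\prod_i c i)%:E)%E.
Proof.
move=> mZ indep.
have mZB i B : measurable B -> measurable (Z i @^-1` B).
  by move=> mB; rewrite -[_ @^-1` _]setTI; exact: mZ.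
(* The factors outside [s] are indicators; they are replaced one at a time. *)
suff H (s : seq I) h' c' : (forall i, i \notin s ->
      exists2 B, measurable B & h' i = \1_B :> (S -> R)) ->
    (forall i, measurable_fun setT (h' i)) -> (forall i x, 0 <= h' i x) ->
    (forall i, \int[P]_w (h' i (Z i w))%:E <= (c' i)%:E)%E ->
    (\int[P]_w (\prod_i h' i (Z i w))%:E <= (\prod_i c' i)%:E)%E.
  by apply: (H (enum I)) => i; rewrite mem_enum.
elim: s h' c' => [|k s IH] {}h {}c hs mh h0 hc.
  (* With no index left to replace, the product is the indicator of an intersection and independence
     of events applies. *)
  have {hs}/choice[B hB] i : exists B, measurable B /\ h i = \1_B.
    by have [//|B] := hs i; exists B.
  have -> : (\int[P]_w (\prod_i h i (Z i w))%:E =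
      P (\bigcap_(i in [set` [set: I]%SET]) Z i @^-1` B i))%E.
    rewrite -[X in P X]setIT -integral_indic//; last first.
      by apply: fin_bigcap_measurable => // i _; apply: mZB; case: (hB i).
    apply: eq_integral => w _; congr EFin.
    rewrite indicE; case: (boolP (w \in _)) => [/set_mem wB|/negP wB].
      rewrite big1// => i _; have [_ ->] := hB i.
      by rewrite indicE mem_set//; apply: wB; rewrite /= inE.
    apply/eqP/prodf_eq0; apply: contra_notP wB => nex; apply/mem_set => i _ /=.
    apply: contrapT => nB; apply: nex; exists i => //.
    by have [_ ->] := hB i; rewrite indicE memNset.
  rewrite indep; last by move=> i; case: (hB i).
  have PB i : P (Z i @^-1` B i) = (fine (P (Z i @^-1` B i)))%:E.
    by rewrite fineK// fin_num_measure//; apply: mZB; case: (hB i).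
  rewrite (eq_bigr _ (fun i _ => PB i)).
  rewrite prodEFin lee_fin big_mkcond /=; apply: ler_prod => i _.
  rewrite inE fine_ge0// -lee_fin -PB (le_trans _ (hc i))//.
  have [mB ->] := hB i; have := integral_indic P measurableT (mZB i _ mB).
  by rewrite setIT => <-.
have c0 i : 0 <= c i.
  rewrite -lee_fin (le_trans _ (hc i))// integral_ge0// => x _.
  by rewrite lee_fin.
pose W w := \prod_(i | i != k) h i (Z i w).
have mW : measurable_fun setT W.
  rewrite /W; under eq_fun do rewrite big_mkcond.
  apply: measurable_prod => i _; case: (i != k) => //.
  exact: measurableT_comp.
have W0 w : 0 <= W w by apply: prodr_ge0.
have K0 : 0 <= \prod_(i | i != k) c i by apply: prodr_ge0.
have -> : (\int[P]_w (\prod_i h i (Z i w))%:E =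
    \int[P]_w (h k (Z k w) * W w)%:E)%E.
  by apply: eq_integral => w _; rewrite (bigD1 k).
apply: (le_trans (ge0_integral_comp_mul_le (mZ k) mW W0 K0 _ (mh k) (h0 k))).
  (* The required bound on the event that [Z k] lies in [B] is the induction hypothesis for the
     family whose factor at [k] is [\1_B]. *)
  move=> B mB; pose h' i := if i == k then \1_B else h i : S -> R.
  pose c' i := if i == k then fine (P (Z k @^-1` B)) else c i.
  have PB : P (Z k @^-1` B) = (fine (P (Z k @^-1` B)))%:E.
    by rewrite fineK// fin_num_measure//; apply: mZB.
  rewrite -[X in (_ <= _ * X)%E]/(P (Z k @^-1` B)) PB -EFinM.
  rewrite integral_mkcond epatch_indic.
  have := IH h' c'.
  rewrite (bigD1 k)//= {2}/c' eqxx mulrC.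
  rewrite (eq_bigr c) => [|i /negPf ik]; last by rewrite /c' ik.
  under eq_integral do (rewrite (bigD1 k)//= {1}/h' eqxx mulrC;
    under eq_bigr => i /negPf ik do rewrite /h' ik).
  apply.
  - move=> i ni; rewrite /h'; case: eqVneq => [_|ik]; first by exists B.
    by apply: hs; rewrite inE negb_or ik.
  - move=> i; rewrite /h'; case: eqVneq => // _; exact: measurable_indic.
  - by move=> i x; rewrite /h'; case: eqVneq => // _; rewrite indicE.
  - move=> i; rewrite /h' /c'; case: eqVneq => [->|_]; last exact: hc.
    rewrite -PB; have := integral_indic P measurableT (mZB k _ mB).
    by rewrite setIT => <-.
by rewrite [X in (_ <= X%:E)%E](bigD1 k)//= [c k * _]mulrC EFinM lee_wpmul2l.
Qed.

End Independence.

Section Laws.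
Context (R : realType) (disp disp' : measure_display)
  (Omega : measurableType disp) (S : measurableType disp')
  (P : probability Omega R).

Lemma integral_probability_cst (r : R) : (\int[P]_w r%:E = r%:E)%E.
Proof. by rewrite integral_cst// [X in (_ * X)%E]probability_setT mule1. Qed.

Lemma eq_expectation_identical_law (F G : Omega -> S) (h : S -> R) :
  measurable_fun setT F -> measurable_fun setT G ->
  (forall A, measurable A -> P (F @^-1` A) = P (G @^-1` A)) ->
  measurable_fun setT h -> (forall x, 0 <= h x) ->
  (\int[P]_w (h (F w))%:E = \int[P]_w (h (G w))%:E)%E.
Proof.
move=> mF mG FG mh h0.
have mh' : measurable_fun setT (EFin \o h) by exact/measurable_EFinP.
pose mixF := isMeasurableFun.Build _ _ _ _ F mF.
pose mixG := isMeasurableFun.Build _ _ _ _ G mG.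
pose F' : {mfun Omega >-> S} := HB.pack F mixF.
pose G' : {mfun Omega >-> S} := HB.pack G mixG.
have h'0 x : (0 <= (EFin \o h) x)%E by rewrite lee_fin.
have := @ge0_integral_distribution _ _ _ _ _ P F' _ mh' h'0.
have := @ge0_integral_distribution _ _ _ _ _ P G' _ mh' h'0.
rewrite /comp /= => <- <-.
by apply: eq_measure_integral => A mA _; exact: FG.
Qed.

(** On a rectangle with sides [A] and [B], both probabilities are the integral over [A] of a common
    version [g]; rectangles are stable under intersection and generate the product sigma-algebra. *)
Lemma cond_symmetric_joint_law (X : {RV P >-> S}) (eps : {RV P >-> R})
    (D : set (S * R)) :
  cond_symmetric X eps -> measurable D ->
  P ((fun w => (X w, eps w)) @^-1` D) = P ((fun w => (X w, - eps w)) @^-1` D).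
Proof.
move=> sym mD.
have mF : measurable_fun setT (fun w => (X w, eps w)).
  exact: measurable_fun_pair.
have mG : measurable_fun setT (fun w => (X w, - eps w)).
  by apply: measurable_fun_pair => //; exact: measurable_funN.
pose mixF := isMeasurableFun.Build _ _ _ _ _ mF.
pose mixG := isMeasurableFun.Build _ _ _ _ _ mG.
pose F : {mfun Omega >-> (S * R)%type} := HB.pack (fun w => (X w, eps w)) mixF.
pose G : {mfun Omega >-> (S * R)%type} :=
  HB.pack (fun w => (X w, - eps w)) mixG.
apply: (@measure_unique _ R _
  [set A `*` B | A in measurable & B in measurable] (fun=> setT) _ _ _ _
  (distribution P F) (distribution P G)) => //.
- exact: measurable_prod_measurableType.
- move=> _ _ [A mA [B mB <-]] [A' mA' [B' mB' <-]].
  exists (A `&` A'); first exact: measurableI.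
  by exists (B `&` B'); [exact: measurableI|rewrite setXI].
- by move=> _; exists setT => //; exists setT => //; rewrite setXTT.
- by rewrite bigcup_const//; exists 0%N.
- move=> _ [A mA [B mB <-]].
  have mXA : measurable (X @^-1` A).
    by rewrite -[_ @^-1` _]setTI; exact: measurable_funP.
  have mN : measurable_fun setT (fun w => - eps w) by exact: measurable_funN.
  have mB1 : measurable (eps @^-1` B).
    by rewrite -[_ @^-1` _]setTI; exact: measurable_funP.
  have mB2 : measurable ((fun w => - eps w) @^-1` B).
    by rewrite -[_ @^-1` _]setTI; exact: mN.
  have [g [[_ _ /(_ _ mA) g1] [_ _ /(_ _ mA)]]] := sym B mB.
  rewrite -g1 => e.
  have := integral_indic P mXA mB1.
  have := integral_indic P mXA mB2.
  rewrite /distribution /pushforward /= => e1 e2.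
  transitivity (P (eps @^-1` B `&` X @^-1` A)); first by rewrite setIC.
  rewrite -[LHS]e2; transitivity (P ((fun w => - eps w) @^-1` B `&` X @^-1` A)).
    by rewrite -[RHS]e1; exact: (esym e).
  by rewrite setIC.
- move=> _; rewrite ltey_eq fin_num_measure//.
Qed.

End Laws.

(** * Exponential moments *)

Section Subgaussian.
Context (R : realType).

Lemma onem_mul_expR_le1 (z : R) : (1 - z) * expR z <= 1.
Proof.
have := expR_ge1Dx (- z); rewrite expRN => h.
by rewrite -ler_pdivlMr ?expR_gt0// div1r.
Qed.

(** For [z <= 0] one has (1 - z)(1 + z + z^2) = 1 - z^3 >= 1 >= (1 - z) exp z. *)
Lemma expR_le_quadratic_npos (z : R) : z <= 0 -> expR z <= 1 + z + z ^+ 2.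
Proof.
move=> z0; have := onem_mul_expR_le1 z; have := expR_ge1Dx z.
have := expR_gt0 z; nra.
Qed.

(** For [z >= 0], exp z <= 1 + z exp z is used twice; for [z < 0] the previous bound is stronger. *)
Lemma expR_le_1Dx_sqr (z : R) : expR z <= 1 + z + z ^+ 2 * expR `|z|.
Proof.
have [z0|z0] := leP 0 z.
  have := onem_mul_expR_le1 z; have := expR_gt0 z.
  rewrite ger0_norm//; nra.
have h := expR_le_quadratic_npos (ltW z0).
have : 1 <= expR `|z| by apply: le_trans (expR_ge1Dx _); rewrite lerDl.
have := sqr_ge0 z; nra.
Qed.

(** The first-order terms cancel. As |u| <= 1 and e^2 <= 4 exp |e|, each remainder is at most 4 u^2
    exp(2|e|), and exp(2|e|) is at most the sum of the two exponentials on the right. *)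
Lemma cosh_mul_le (u e : R) : `|u| <= 1 ->
  expR (u * e) + expR (- (u * e)) <=
  2 + 8 * u ^+ 2 * (expR (2 * e) + expR (2 * - e)).
Proof.
move=> u1.
have h1 := expR_le_1Dx_sqr (u * e).
have h2 := expR_le_1Dx_sqr (- (u * e)); rewrite sqrrN normrN in h2.
have ue : expR `|u * e| <= expR `|e|.
  by rewrite ler_expR normrM ler_piMl.
have e2 : e ^+ 2 <= 4 * expR `|e|.
  have := expR_ge1Dx (`|e| / 2); set y := expR _ => hy.
  have -> : expR `|e| = y ^+ 2.
    by rewrite /y expr2 -expRD; congr expR; lra.
  have -> : e ^+ 2 = `|e| ^+ 2 by rewrite -normrX ger0_norm// sqr_ge0.
  have := normr_ge0 e; nra.
have ee : expR `|e| ^+ 2 <= expR (2 * e) + expR (2 * - e).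
  rewrite expr2 -expRD; have := expR_gt0 (2 * e); have := expR_gt0 (2 * - e).
  have E x : x + x = 2 * x :> R by ring.
  by case: (ger0P e) => _; rewrite E; lra.
have : (u * e) ^+ 2 * expR `|u * e| <= 4 * u ^+ 2 * expR `|e| ^+ 2.
  have -> : 4 * u ^+ 2 * expR `|e| ^+ 2 =
    u ^+ 2 * ((4 * expR `|e|) * expR `|e|) by ring.
  have -> : (u * e) ^+ 2 * expR `|u * e| = u ^+ 2 * (e ^+ 2 * expR `|u * e|).
    by ring.
  by rewrite ler_wpM2l ?sqr_ge0// ler_pM ?sqr_ge0 ?expR_ge0.
have := sqr_ge0 u; nra.
Qed.

Context (disp disp' : measure_display) (Omega : measurableType disp)
  (S : measurableType disp') (P : probability Omega R) (b : R)
  (X : {RV P >-> S}) (eps : {RV P >-> R}).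
Hypotheses (sym : cond_symmetric X eps) (subg : cond_subgaussian b X eps).

Lemma cond_symmetric_expectation (h : S * R -> R) :
  measurable_fun setT h -> (forall x, 0 <= h x) ->
  (\int[P]_w (h (X w, eps w))%:E = \int[P]_w (h (X w, - eps w))%:E)%E.
Proof.
move=> mh h0.
apply: (@eq_expectation_identical_law _ _ _ _ _ _
  (fun w => (X w, eps w)) (fun w => (X w, - eps w))) => //.
- exact: measurable_fun_pair.
- by apply: measurable_fun_pair => //; exact: measurable_funN.
- by move=> A; exact: cond_symmetric_joint_law.
Qed.

(** This integrated form pulls a nonnegative function of [X] out of the conditional expectation. *)
Lemma cond_subgaussian_expectation (t : R) (h : S -> R) : 0 < t ->
  measurable_fun setT h -> (forall x, 0 <= h x) ->
  (\int[P]_w (h (X w) * expR (t * eps w))%:E <=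
   (expR (b ^+ 2 * t ^+ 2 / 2))%:E * \int[P]_w (h (X w))%:E)%E.
Proof.
move=> t0 mh h0.
apply: (ge0_integral_comp_mul_le (Phi := X) (W := fun w => expR (t * eps w))
  (h := h)) => //.
- by apply: measurableT_comp => //; exact: measurable_funM.
move=> B mB; have [g [mg g0 gB] gle] := subg t0.
rewrite gB//.
have -> : ((expR (b ^+ 2 * t ^+ 2 / 2))%:E * P (X @^-1` B) =
    \int[distribution P X]_(x in B) (expR (b ^+ 2 * t ^+ 2 / 2))%:E)%E.
  by rewrite integral_cst.
apply: ae_ge0_le_integral => //.
- exact: measurable_funTS.
- by apply: filterS gle => x gx _; exact: gx.
Qed.

(** Symmetrisation: by symmetry, twice the left side is the expectation of [v] times exp(u eps) +
    exp(- u eps), and [cosh_mul_le] removes the term linear in [u]. *)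
Lemma mgf_le (v u : S -> R) :
  measurable_fun setT v -> (forall x, 0 <= v x) -> measurable_fun setT u ->
  {ae P, forall w, `|u (X w)| <= 1} ->
  (\int[P]_w (v (X w) * expR (u (X w) * eps w))%:E <=
   \int[P]_w (v (X w) * (1 + 8 * expR (2 * b ^+ 2) * u (X w) ^+ 2))%:E)%E.
Proof.
move=> mv v0 mu u1.
pose K := expR (2 * b ^+ 2).
have mvX : measurable_fun setT (v \o X) by exact: measurableT_comp.
have muX : measurable_fun setT (u \o X) by exact: measurableT_comp.
pose w2 x := 8 * u x ^+ 2 * v x.
have mw2 : measurable_fun setT w2.
  do 2 apply: measurable_funM => //.
  exact: measurable_funX.
have w20 x : 0 <= w2 x by rewrite mulr_ge0// mulr_ge0// sqr_ge0.
have mw2X : measurable_fun setT (w2 \o X) by exact: measurableT_comp.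
pose H (p : S * R) := v p.1 * expR (u p.1 * p.2).
have mH : measurable_fun setT H.
  apply: measurable_funM; first exact: measurableT_comp.
  apply: measurableT_comp => //; apply: measurable_funM => //.
  exact: measurableT_comp.
have H0 p : 0 <= H p by rewrite mulr_ge0// expR_ge0.
pose G (p : S * R) := w2 p.1 * expR (2 * p.2).
have mG : measurable_fun setT G.
  apply: measurable_funM; first exact: measurableT_comp.
  by apply: measurableT_comp => //; exact: measurable_funM.
have G0 p : 0 <= G p by rewrite mulr_ge0// expR_ge0.
have mF1 : measurable_fun setT (fun w => (X w, eps w)).
  exact: measurable_fun_pair.
have mF2 : measurable_fun setT (fun w => (X w, - eps w)).
  by apply: measurable_fun_pair => //; exact: measurable_funN.
have mHF1 : measurable_fun setT (fun w => H (X w, eps w)).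
  exact: (measurableT_comp mH mF1).
have mHF2 : measurable_fun setT (fun w => H (X w, - eps w)).
  exact: (measurableT_comp mH mF2).
have mGF1 : measurable_fun setT (fun w => G (X w, eps w)).
  exact: (measurableT_comp mG mF1).
have mGF2 : measurable_fun setT (fun w => G (X w, - eps w)).
  exact: (measurableT_comp mG mF2).
(* Subgaussianity is used only at t = 2, where b^2 t^2 / 2 = 2 b^2. *)
have G2 : (\int[P]_w (G (X w, eps w))%:E <= K%:E * \int[P]_w (w2 (X w))%:E)%E.
  have := @cond_subgaussian_expectation 2 w2 (ltr0n _ 2) mw2 w20.
  by rewrite (_ : b ^+ 2 * 2 ^+ 2 / 2 = 2 * b ^+ 2)//; field.
have dbl (x : \bar R) : (x + x = 2%:E * x)%E.
  by rewrite -[in LHS](mul1e x) -ge0_muleDl// -EFinD.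
rewrite -(@lee_pmul2l _ 2%:E)//.
rewrite -!dbl.
have -> : (\int[P]_w (v (X w) * expR (u (X w) * eps w))%:E =
  \int[P]_w (H (X w, eps w))%:E)%E by [].
have -> : (\int[P]_w (v (X w) * (1 + 8 * expR (2 * b ^+ 2) * u (X w) ^+ 2))%:E
    = \int[P]_w (v (X w))%:E + K%:E * \int[P]_w (w2 (X w))%:E)%E.
  rewrite -ge0_integralZl_EFin//; last 3 first.
  - by move=> w _; rewrite lee_fin.
  - exact/measurable_EFinP.
  - exact: expR_ge0.
  rewrite -ge0_integralD//; last 4 first.
  - by move=> w _; rewrite lee_fin.
  - exact/measurable_EFinP.
  - by move=> w _; rewrite -EFinM lee_fin mulr_ge0// expR_ge0.
  - by apply/measurable_EFinP; exact: measurable_funM.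
  apply: eq_integral => w _; rewrite -EFinM -EFinD; congr EFin.
  by rewrite /w2 /K; ring.
rewrite {2}(cond_symmetric_expectation mH H0).
rewrite -ge0_integralD//; last 4 first.
- by move=> w _; rewrite lee_fin.
- exact/measurable_EFinP.
- by move=> w _; rewrite lee_fin.
- exact/measurable_EFinP.
apply: (@le_trans _ _ (\int[P]_w ((2 * v (X w))%:E +
    ((G (X w, eps w))%:E + (G (X w, - eps w))%:E)))%E).
  apply: ae_ge0_le_integral => //.
  - by move=> w _; rewrite -EFinD lee_fin addr_ge0.
  - by apply: emeasurable_funD; exact/measurable_EFinP.
  - by move=> w _; rewrite -!EFinD lee_fin !addr_ge0// mulr_ge0.
  - apply: emeasurable_funD.
      by apply/measurable_EFinP; exact: measurable_funM.
    by apply: emeasurable_funD; exact/measurable_EFinP.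
  - apply: filterS u1 => w uw _; rewrite -!EFinD lee_fin /H /G /w2 /=.
    have := cosh_mul_le (eps w) uw; rewrite [u (X w) * - _]mulrN.
    move: (expR _) (expR _) (expR _) (expR _) => x y z t h.
    rewrite -mulrDr [X in _ <= X](_ : _ =
      v (X w) * (2 + 8 * u (X w) ^+ 2 * (y + x))); last by ring.
    exact: ler_wpM2l.
rewrite ge0_integralD//; last 4 first.
- by move=> w _; rewrite lee_fin mulr_ge0.
- by apply/measurable_EFinP; exact: measurable_funM.
- by move=> w _; rewrite -EFinD lee_fin addr_ge0.
- by apply: emeasurable_funD; exact/measurable_EFinP.
rewrite ge0_integralD//; last 4 first.
- by move=> w _; rewrite lee_fin.
- exact/measurable_EFinP.
- by move=> w _; rewrite lee_fin.
- exact/measurable_EFinP.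
(* Subgaussianity is assumed for positive [t]; symmetry transfers it to exp(-2 eps). *)
rewrite -(cond_symmetric_expectation mG G0).
under eq_integral do rewrite EFinM.
rewrite ge0_integralZl_EFin//; last 2 first.
- by move=> w _; rewrite lee_fin.
- exact/measurable_EFinP.
by rewrite -dbl [leRHS]addeACA leeD2l// leeD.
Qed.

End Subgaussian.

Section ExcessLoss.
Context (R : realType) (disp disp' : measure_display)
  (Omega : measurableType disp) (S : measurableType disp')
  (P : probability Omega R) (b : R) (X : {RV P >-> S}) (eps : {RV P >-> R}).
Hypotheses (sym : cond_symmetric X eps) (subg : cond_subgaussian b X eps).
Variables (sigma Q G : R) (g : S -> R).
Hypotheses (sigma0 : 0 < sigma) (Q0 : 0 < Q) (mg : measurable_fun setT g)
  (gQ : {ae P, forall w, `|g (X w)| <= Q})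
  (gG : (\int[P]_w ((g (X w)) ^+ 2)%:E = G%:E)%E).

Let K := 8 * expR (2 * b ^+ 2).

Let K0 : 0 <= K. Proof. by rewrite mulr_ge0. Qed.

Let mgX2 : measurable_fun setT (fun w => g (X w) ^+ 2).
Proof. by apply: measurable_funX; exact: measurableT_comp. Qed.

(** This controls the noise of the competitor, whose linear term z is replaced by (exp(s z) - 1) / s
    >= z to keep integrands nonnegative. The excess over 1 is of order s^2, hence still small after
    division by [s]. *)
Lemma excess_loss_noise_mgf (s : R) : 0 < s -> 2 * s * sigma * Q <= 1 ->
  (\int[P]_w (expR (- 2 * s * (g (X w) * (sigma * eps w))))%:E <=
   (1 + 4 * K * s ^+ 2 * sigma ^+ 2 * G)%:E)%E.
Proof.
move=> s0 sQ.
have mu : measurable_fun setT (fun x => - 2 * s * sigma * g x).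
  exact: measurable_funM.
have u1 : {ae P, forall w, `|- 2 * s * sigma * g (X w)| <= 1}.
  apply: filterS gQ => w gw; rewrite !normrM normrN.
  rewrite (gtr0_norm s0) (gtr0_norm sigma0) (@gtr0_norm _ 2)//.
  by apply: le_trans sQ; rewrite ler_wpM2l// !mulr_ge0// ltW.
have := mgf_le sym subg (v := fun=> 1) (measurable_cst _) (fun=> ler01) mu u1.
rewrite -/K => h.
set c := 4 * K * s ^+ 2 * sigma ^+ 2.
have c0 : 0 <= c by rewrite mulr_ge0 ?sqr_ge0// mulr_ge0 ?sqr_ge0// mulr_ge0.
have e1 : (\int[P]_w (expR (- 2 * s * (g (X w) * (sigma * eps w))))%:E =
    \int[P]_w (1 * expR (- 2 * s * sigma * g (X w) * eps w))%:E)%E.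
  by apply: eq_integral => w _; rewrite mul1r; congr (expR _)%:E; ring.
rewrite e1; apply: (le_trans h).
have -> : (\int[P]_w (1 * (1 + K * (- 2 * s * sigma * g (X w)) ^+ 2))%:E =
    \int[P]_w (1%:E + c%:E * (g (X w) ^+ 2)%:E))%E.
  apply: eq_integral => w _; rewrite mul1r -EFinM -EFinD; congr EFin.
  by rewrite /c; ring.
rewrite ge0_integralD//; last 2 first.
- by move=> w _; rewrite -EFinM lee_fin mulr_ge0// sqr_ge0.
- by apply/measurable_EFinP; exact: measurable_funM.
rewrite integral_probability_cst ge0_integralZl_EFin//; last 2 first.
- by move=> w _; rewrite lee_fin sqr_ge0.
- exact/measurable_EFinP.
by rewrite gG.
Qed.

(** Take v = exp(- c lam g^2) and u = 2 c lam sigma g in [mgf_le], with lam = 1 + alpha; the first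
    condition gives |u| <= 1. With x = c g^2, v (1 + K u^2) is at most 1 - lam x + (lam x)^2 + 4 K c
    lam^2 sigma^2 x. The other two conditions bound each of the last two terms by alpha x / 2,
    leaving 1 - x, and 1 - c G <= exp(- c G). *)
Lemma excess_loss_mgf (c alpha : R) : 0 < c -> 0 < alpha ->
  2 * c * (1 + alpha) * sigma * Q <= 1 ->
  (1 + alpha) ^+ 2 * c * Q ^+ 2 <= alpha / 2 ->
  4 * K * c * (1 + alpha) ^+ 2 * sigma ^+ 2 <= alpha / 2 ->
  (\int[P]_w (expR (c * (G - (1 + alpha) *
     (g (X w) ^+ 2 - 2 * (g (X w) * (sigma * eps w))))))%:E <= 1)%E.
Proof.
move=> c0 al0 h1 h2 h3.
set lam := 1 + alpha in h1 h2 h3 *.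
have lam0 : 0 < lam by rewrite /lam; lra.
pose v x := expR (- (c * lam * g x ^+ 2)).
have mv : measurable_fun setT v.
  apply: measurableT_comp => //; apply: measurable_funN.
  by apply: measurable_funM => //; exact: measurable_funX.
have v0 x : 0 <= v x by exact: expR_ge0.
pose u x := 2 * c * lam * sigma * g x.
have mu : measurable_fun setT u by exact: measurable_funM.
have u1 : {ae P, forall w, `|u (X w)| <= 1}.
  apply: filterS gQ => w gw; rewrite !normrM (gtr0_norm c0) (gtr0_norm lam0).
  rewrite (gtr0_norm sigma0) (@gtr0_norm _ 2)//.
  by apply: le_trans h1; rewrite ler_wpM2l// !mulr_ge0// ltW.
have := mgf_le sym subg mv v0 mu u1; rewrite -/K => hm.
have mX2 : measurable_fun setT (fun w => v (X w) * (1 + K * u (X w) ^+ 2)).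
  apply: measurable_funM; first exact: measurableT_comp.
  apply: measurable_funD => //; apply: measurable_funM => //.
  by apply: measurable_funX; exact: measurableT_comp.
have p0 w : 0 <= v (X w) * (1 + K * u (X w) ^+ 2).
  by rewrite mulr_ge0// addr_ge0// mulr_ge0// sqr_ge0.
have hG : (\int[P]_w (v (X w) * (1 + K * u (X w) ^+ 2))%:E <= (1 - c * G)%:E)%E.
  (* As [G] is the expectation of g(X)^2, it suffices to show v (1 + K u^2) + c g^2 <= 1 almost
     surely. *)
  rewrite EFinB leeBrDr// EFinM -gG.
  rewrite -ge0_integralZl_EFin ?(ltW c0)//; last 2 first.
  - by move=> w _; rewrite lee_fin sqr_ge0.
  - exact/measurable_EFinP.
  rewrite -ge0_integralD//; last 4 first.
  - by move=> w _; rewrite lee_fin.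
  - exact/measurable_EFinP.
  - by move=> w _; rewrite -EFinM lee_fin mulr_ge0 ?sqr_ge0// ltW.
  - by apply/measurable_EFinP; exact: measurable_funM.
  have -> : (1 = \int[P]_w 1%:E :> \bar R)%E.
    by rewrite integral_probability_cst.
  apply: ae_ge0_le_integral => //.
  - move=> w _; rewrite -EFinM -EFinD lee_fin addr_ge0// mulr_ge0 ?sqr_ge0//.
    exact: ltW.
  - apply: emeasurable_funD; first exact/measurable_EFinP.
    by apply/measurable_EFinP; exact: measurable_funM.
  apply: filterS gQ => w gw _; rewrite -EFinM -EFinD lee_fin.
  have y0 : 0 <= g (X w) ^+ 2 by exact: sqr_ge0.
  have yQ : g (X w) ^+ 2 <= Q ^+ 2.
    by rewrite -[X in X <= _]ger0_norm// normrX ler_sqr ?nnegrE// ltW.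
  rewrite /u !exprMn /v; set y := g (X w) ^+ 2 in y0 yQ *.
  set x := c * y; have x0 : 0 <= x by rewrite mulr_ge0// ltW.
  have z0 : 0 <= lam * x by rewrite mulr_ge0// ltW.
  have vx : expR (- (c * lam * y)) <= 1 - lam * x + (lam * x) ^+ 2.
    have := @expR_le_quadratic_npos _ (- (lam * x)); rewrite sqrrN oppr_le0 z0.
    by rewrite (_ : c * lam * y = lam * x); [exact|rewrite /x; ring].
  have v1 : expR (- (c * lam * y)) <= 1.
    rewrite -[leRHS]expR0 ler_expR oppr_le0.
    by rewrite (_ : c * lam * y = lam * x)// /x; ring.
  set t := expR _ in vx v1 *; have t0 : 0 <= t by exact: expR_ge0.
  set kap := 4 * K * c * lam ^+ 2 * sigma ^+ 2 in h3.
  have kap0 : 0 <= kap * x.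
    rewrite mulr_ge0// /kap mulr_ge0 ?sqr_ge0// mulr_ge0 ?sqr_ge0//.
    by rewrite mulr_ge0 ?(ltW c0)// mulr_ge0.
  have -> : K * (2 ^+ 2 * c ^+ 2 * lam ^+ 2 * sigma ^+ 2 * y) = kap * x.
    by rewrite /kap /x; ring.
  have q1 : (lam * x) ^+ 2 <= alpha / 2 * x.
    apply: le_trans (ler_wpM2r x0 h2).
    have -> : (lam * x) ^+ 2 = lam ^+ 2 * c * y * x by rewrite /x; ring.
    by rewrite ler_wpM2r// ler_wpM2l// mulr_ge0 ?sqr_ge0// ltW.
  have q2 : kap * x <= alpha / 2 * x by rewrite ler_wpM2r.
  have q3 : t * (kap * x) <= kap * x by rewrite ler_piMl.
  have q4 : lam * x = x + alpha * x by rewrite /lam; ring.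
  lra.
apply: (@le_trans _ _ ((expR (c * G))%:E * (1 - c * G)%:E)%E).
  apply: (le_trans _ (lee_wpmul2l _ (le_trans hm hG))).
    rewrite -ge0_integralZl_EFin ?expR_ge0//.
    - rewrite le_eqVlt; apply/orP; left; apply/eqP; apply: eq_integral => w _.
      by rewrite -EFinM /v /u -!expRD; congr (expR _)%:E; ring.
    - by move=> w _; rewrite lee_fin mulr_ge0// expR_ge0.
    - apply/measurable_EFinP/measurable_funM; first exact: measurableT_comp.
      apply: measurableT_comp => //; apply: measurable_funM => //.
      exact: measurableT_comp.
  by rewrite lee_fin expR_ge0.
rewrite -EFinM lee_fin.
rewrite -[leRHS]expR0 -(subrr (c * G)) expRD ler_wpM2l ?expR_ge0//.
exact: expR_ge1Dx.
Qed.
End ExcessLoss.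

(** * Gibbs weights and the aggregate *)

Section Gibbs.
Context (R : realType) (L : finType).
Implicit Types (u A G : L -> R).

Local Notation M := (#|L|%:R : R).

Definition gibbs u (l : L) : R := expR (- u l) / \sum_k expR (- u k).

Lemma gibbs_ge0 u l : 0 <= gibbs u l.
Proof. by rewrite divr_ge0 ?expR_ge0// sumr_ge0. Qed.

Hypothesis L0 : (0 < #|L|)%N.

Lemma gibbs_partition_gt0 u : 0 < \sum_k expR (- u k).
Proof.
have [l _] := card_gt0P L0.
by rewrite (bigD1 l)//= ltr_pwDl ?expR_gt0// sumr_ge0.
Qed.

Lemma sum_gibbs u : \sum_l gibbs u l = 1.
Proof. by rewrite -mulr_suml divff// gt_eqF// gibbs_partition_gt0. Qed.

Let M0 : 0 < M. Proof. by rewrite ltr0n. Qed.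

(* The weights minimise [theta |-> sum_l theta_l u_l + KL(theta | uniform)]
   over the simplex. *)
Lemma gibbs_variational u l0 : \sum_l gibbs u l * u l <= u l0 + ln M.
Proof.
have S0 := gibbs_partition_gt0 u; set S := \sum_k expR (- u k) in S0.
have lnS : - u l0 <= ln S.
  by rewrite -ler_expR lnK ?posrE// /S (bigD1 l0)//= lerDl sumr_ge0.
(* Nonnegativity of KL: [ln S + u l] is minus the logarithm of the weight theta_l, and 1 + x <= exp
   x gives theta_l ln(1 / (M theta_l)) <= 1/M - theta_l, which sums to 0. *)
suff : \sum_l gibbs u l * (ln S + u l - ln M) <=
    \sum_(l : L) (M^-1 - gibbs u l).
  have -> : \sum_(l : L) (M^-1 - gibbs u l) = 0.
    rewrite sumrB sum_gibbs sumr_const -[_^-1 *+ _]mulr_natl.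
    by rewrite divff ?gt_eqF// subrr.
  have : \sum_l gibbs u l * (ln S + u l - ln M) =
      ln S - ln M + \sum_l gibbs u l * u l.
    rewrite -[ln S - ln M]mul1r -[X in X * _](sum_gibbs u) mulr_suml -big_split.
    by apply: eq_bigr => l _ /=; ring.
  lra.
apply: ler_sum => l _.
have := expR_ge1Dx (ln S + u l - ln M).
rewrite !expRD expRN !lnK ?posrE// => h.
have t0 : 0 < gibbs u l by rewrite divr_gt0 ?expR_gt0.
apply: (@le_trans _ _ (gibbs u l * (S * expR (u l) / M - 1))).
  by rewrite ler_pM2l//; lra.
rewrite mulrBr mulr1 lerD2r /gibbs -/S expRN.
by rewrite (_ : _ * _ = M^-1)//; field; rewrite !gt_eqF ?expR_gt0.
Qed.

(** A maximal inequality linear in the exponentials, from 1 + x <= exp x at x = [A l - ln M].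
    Expectations can be taken term by term, and only [ln M] remains when each exponential has mean
    at most 1. *)
Lemma le_ln_card_sum_expR A l :
  A l <= ln M + (\sum_k expR (A k)) / M - 1.
Proof.
have := expR_ge1Dx (A l - ln M); rewrite expRD expRN lnK ?posrE// => h.
have : expR (A l) / M <= (\sum_k expR (A k)) / M.
  by rewrite ler_pM2r ?invr_gt0// (bigD1 l)//= lerDl sumr_ge0.
lra.
Qed.

(** Split [G] as [lam * A] plus [G - lam * A]. The variational bound treats the first part, where
    the shift [r0] drops out because the weights sum to 1; the maximal inequality treats the
    second. *)
Lemma gibbs_oracle (n T c lam r0 : R) G A l0 :
  0 < n -> 0 < T -> 0 < c -> 0 <= lam ->
  \sum_l gibbs (fun k => n * (r0 + A k) / T) l * G l <=
  lam * (A l0 + T * ln M / n) +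
  (ln M + (\sum_k expR (n * c * (G k - lam * A k))) / M - 1) / (n * c).
Proof.
move=> n0 T0 c0 lam0; set u := fun k => n * _ / T; set Z := _ / (n * c).
have nc0 : 0 < n * c by rewrite mulr_gt0.
have hA : \sum_l gibbs u l * A l <= A l0 + T * ln M / n.
  have -> : \sum_l gibbs u l * A l = T / n * (\sum_l gibbs u l * u l) - r0.
    rewrite -[r0]mul1r -(sum_gibbs u) mulr_suml mulr_sumr -sumrB.
    by apply: eq_bigr => l _; rewrite /u; field; rewrite !gt_eqF.
  rewrite lerBlDr (_ : _ + r0 = T / n * (u l0 + ln M)).
    by rewrite ler_wpM2l ?gibbs_variational// divr_ge0// ltW.
  by rewrite /u; field; rewrite !gt_eqF.
have hG : \sum_l gibbs u l * (G l - lam * A l) <= Z.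
  rewrite -[Z]mul1r -(sum_gibbs u) mulr_suml; apply: ler_sum => l _.
  rewrite ler_wpM2l ?gibbs_ge0// ler_pdivlMr// mulrC.
  exact: (le_ln_card_sum_expR (fun k => n * c * (G k - lam * A k))).
have -> : \sum_l gibbs u l * G l =
    lam * (\sum_l gibbs u l * A l) + \sum_l gibbs u l * (G l - lam * A l).
  by rewrite mulr_sumr -big_split; apply: eq_bigr => l _ /=; ring.
by rewrite lerD// ler_wpM2l.
Qed.

(** The variance of [G] under the weights is nonnegative. *)
Lemma sqr_sum_gibbs_le u G : (\sum_l gibbs u l * G l) ^+ 2 <=
  \sum_l gibbs u l * G l ^+ 2.
Proof.
set m := \sum_l gibbs u l * G l; have mE : m = \sum_l gibbs u l * G l by [].
clearbody m.
have : 0 <= \sum_l gibbs u l * (G l - m) ^+ 2.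
  by apply: sumr_ge0 => l _; rewrite mulr_ge0 ?gibbs_ge0 ?sqr_ge0.
have -> : \sum_l gibbs u l * (G l - m) ^+ 2 =
    \sum_l gibbs u l * G l ^+ 2 - 2 * m * (\sum_l gibbs u l * G l) +
    m ^+ 2 * (\sum_l gibbs u l).
  rewrite !mulr_sumr -sumrB -big_split.
  by apply: eq_bigr => l _ /=; ring.
rewrite sum_gibbs -mE; nra.
Qed.

End Gibbs.

Section ExpectationBounds.
Context (R : realType) (disp : measure_display) (Omega : measurableType disp)
  (P : probability Omega R).

Lemma le_expectation_add (F1 F2 : Omega -> R) (m1 m2 : R) :
  measurable_fun setT F1 -> measurable_fun setT F2 ->
  (forall w, 0 <= F1 w) -> (forall w, 0 <= F2 w) ->
  (\int[P]_w (F1 w)%:E <= m1%:E)%E -> (\int[P]_w (F2 w)%:E <= m2%:E)%E ->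
  (\int[P]_w (F1 w + F2 w)%:E <= (m1 + m2)%:E)%E.
Proof.
move=> mF1 mF2 F10 F20 h1 h2; under eq_integral do rewrite EFinD.
rewrite ge0_integralD//; first by rewrite EFinD leeD.
- by move=> w _; rewrite lee_fin.
- exact/measurable_EFinP.
- by move=> w _; rewrite lee_fin.
- exact/measurable_EFinP.
Qed.

Lemma le_expectation_scale_sum (I : finType) (k : R) (F : I -> Omega -> R)
    (m : I -> R) : 0 <= k ->
  (forall i, measurable_fun setT (F i)) -> (forall i w, 0 <= F i w) ->
  (forall i, \int[P]_w (F i w)%:E <= (m i)%:E)%E ->
  (\int[P]_w (k * \sum_i F i w)%:E <= (k * \sum_i m i)%:E)%E.
Proof.
move=> k0 mF F0 h; under eq_integral do rewrite EFinM -sumEFin.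
rewrite ge0_integralZl_EFin//; last 2 first.
- by move=> w _; apply: sume_ge0 => i _; rewrite lee_fin.
- by apply: emeasurable_sum => i; exact/measurable_EFinP.
rewrite EFinM lee_wpmul2l ?lee_fin// ge0_integral_sum//; last 2 first.
- by move=> i; exact/measurable_EFinP.
- by move=> i w _; rewrite lee_fin.
by rewrite -sumEFin lee_sum.
Qed.

End ExpectationBounds.

Section Aggregation.
Context (R : realType) (d n : nat) (L : finType) (f : L -> d.-tuple R -> R)
  (temp : R) (xs : 'I_n -> d.-tuple R) (ys : 'I_n -> R) (f0 : d.-tuple R -> R).
Hypotheses (n0 : (0 < n)%N) (L0 : (0 < #|L|)%N).

(** This is L_n(g), with the noise recovered from the data as [ys i - f0 (xs i)]. *)
Definition excess_risk (g : d.-tuple R -> R) : R :=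
  n%:R^-1 * \sum_(i < n)
    (g (xs i) ^+ 2 - 2 * (g (xs i) * (ys i - f0 (xs i)))).

(** Equal to n R_n(f_l) / T, with the part common to all [l] isolated in the role of [r0] in
    [gibbs_oracle]. *)
Let potential (l : L) : R :=
  n%:R * (n%:R^-1 * (\sum_(i < n) (ys i - f0 (xs i)) ^+ 2) +
    excess_risk (f l \- f0)) / temp.

Lemma empirical_risk_excess (l : L) : empirical_risk xs ys (f l) =
  n%:R^-1 * (\sum_(i < n) (ys i - f0 (xs i)) ^+ 2) + excess_risk (f l \- f0).
Proof.
rewrite /excess_risk -mulrDr -big_split; congr (_ * _).
by apply: eq_bigr => i _ /=; ring.
Qed.

Lemma agg_weightE (l : L) : agg_weight f temp xs ys (f l) = gibbs potential l.
Proof.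
rewrite /agg_weight /gibbs /potential empirical_risk_excess mulNr.
by congr (_ / _); apply: eq_bigr => k _; rewrite empirical_risk_excess mulNr.
Qed.

Lemma aggregate_sqr_loss_le (x : d.-tuple R) :
  ((aggregate f temp xs ys \- f0) x) ^+ 2 <=
  \sum_l gibbs potential l * ((f l \- f0) x) ^+ 2.
Proof.
have -> : (aggregate f temp xs ys \- f0) x =
    \sum_l gibbs potential l * (f l \- f0) x.
  rewrite /= /aggregate -[X in _ - X]mul1r -(sum_gibbs L0 potential).
  rewrite mulr_suml -sumrB.
  by apply: eq_bigr => l _; rewrite agg_weightE /= mulrBr.
exact: sqr_sum_gibbs_le.
Qed.

Lemma aggregate_sqnormL2_le (mu : {measure set (d.-tuple R) -> \bar R})
    (G : L -> R) :
  (forall l, measurable_fun setT (f l \- f0)) ->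
  (forall l, sqnormL2 mu (f l \- f0) = (G l)%:E) ->
  (sqnormL2 mu (aggregate f temp xs ys \- f0)%R <=
   (\sum_l gibbs potential l * G l)%:E)%E.
Proof.
move=> mf hG.
have mf2 l : measurable_fun setT (fun x => ((f l \- f0) x) ^+ 2).
  by apply: measurable_funX; exact: mf.
apply: (@le_trans _ _ (\int[mu]_x
    (\sum_l gibbs potential l * ((f l \- f0)%R x) ^+ 2)%:E)%E).
  rewrite /sqnormL2; apply: ge0_le_integral_nonmeasurable => x;
    rewrite lee_fin ?sqr_ge0//.
  exact: aggregate_sqr_loss_le.
under eq_integral do rewrite -sumEFin.
rewrite ge0_integral_sum//; last 2 first.
- by move=> l; apply/measurable_EFinP; exact: measurable_funM.
- by move=> l x _; rewrite lee_fin mulr_ge0 ?gibbs_ge0 ?sqr_ge0.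
rewrite -sumEFin; apply: lee_sum => l _.
under eq_integral do rewrite EFinM.
rewrite ge0_integralZl_EFin ?gibbs_ge0//; last 2 first.
- by move=> x _; rewrite lee_fin sqr_ge0.
- exact/measurable_EFinP.
by rewrite [leRHS]EFinM -hG.
Qed.

(** All randomness is gathered in three nonnegative sums with nonnegative coefficients; only a
    deterministic constant is subtracted. Their expectations can then be bounded separately. *)
Lemma aggregate_oracle (G : L -> R) (c lam s : R) (l0 : L) :
  0 < temp -> 0 < c -> 0 < lam -> 0 < s ->
  \sum_l gibbs potential l * G l <=
  (lam / n%:R * \sum_(i < n) (f l0 \- f0) (xs i) ^+ 2 +
   lam / (n%:R * s) * \sum_(i < n)
     expR (- 2 * s * ((f l0 \- f0) (xs i) * (ys i - f0 (xs i)))) +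
   (n%:R * c * #|L|%:R)^-1 * \sum_l \prod_(i < n)
     expR (c * (G l - lam * ((f l \- f0) (xs i) ^+ 2 -
       2 * ((f l \- f0) (xs i) * (ys i - f0 (xs i))))))) +
  (lam * temp + c^-1) * (ln #|L|%:R / n%:R) - (lam / s + (n%:R * c)^-1).
Proof.
move=> t0 c0 lam0 s0.
have n0' : 0 < n%:R :> R by rewrite ltr0n.
have M0 : 0 < #|L|%:R :> R by rewrite ltr0n.
have := gibbs_oracle L0 (n%:R^-1 * (\sum_(i < n) (ys i - f0 (xs i)) ^+ 2)) G
  (fun l => excess_risk (f l \- f0)) l0 n0' t0 c0 (ltW lam0).
move=> /le_trans; apply.
(* The excess risk is an empirical mean, so its exponential factorises over the observations. *)
have -> : \sum_k expR (n%:R * c * (G k - lam * excess_risk (f k \- f0))) =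
   \sum_l \prod_(i < n) expR (c * (G l - lam * ((f l \- f0) (xs i) ^+ 2 -
       2 * ((f l \- f0) (xs i) * (ys i - f0 (xs i)))))).
  apply: eq_bigr => l _; rewrite -expR_sum; congr expR.
  rewrite -mulr_sumr sumrB sumr_const card_ord -mulr_sumr /excess_risk.
  by rewrite -[G l *+ n]mulr_natl; field; rewrite gt_eqF.
set V := \sum_l \prod_(i < n) _.
(* For each observation, with noise term z, this is -2 z <= (exp(-2 s z) - 1) / s. *)
have hA : excess_risk (f l0 \- f0) <=
    n%:R^-1 * (\sum_(i < n) (f l0 \- f0) (xs i) ^+ 2) +
    (n%:R * s)^-1 * (\sum_(i < n)
     expR (- 2 * s * ((f l0 \- f0) (xs i) * (ys i - f0 (xs i))))) - s^-1.
  have -> : s^-1 = (n%:R * s)^-1 * (\sum_(i < n) 1).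
    by rewrite sumr_const card_ord; field; rewrite !gt_eqF.
  rewrite -addrA -mulrBr -sumrB invfM -mulrA -mulrDr ler_wpM2l ?invr_ge0//.
  rewrite mulr_sumr -big_split; apply: ler_sum => i _ /=.
  set z := _ * (ys i - _); rewrite lerD2l.
  have := expR_ge1Dx (- 2 * s * z) => h.
  rewrite [leRHS]mulrC ler_pdivlMr//; lra.
have := ler_wpM2l (ltW lam0) hA.
set SA := \sum_(i < n) (f l0 \- f0) (xs i) ^+ 2.
set SB := \sum_(i < n) expR _; set E := excess_risk _; set lnM := ln _.
set N := n%:R in n0' *; set M := #|L|%:R in M0 *.
move: SA SB E lnM V => SA SB E lnM V h; rewrite -subr_ge0.
rewrite (_ : _ - _ = lam * (N^-1 * SA + (N * s)^-1 * SB - s^-1) - lam * E).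
  by rewrite subr_ge0.
by field; rewrite !gt_eqF.
Qed.

End Aggregation.

(** * The regression model *)

Section Model.
Context (R : realType) (d n : nat) (disp : measure_display)
  (Omega : measurableType disp) (P : probability Omega R)
  (f0 : d.-tuple R -> R) (sigma b Q : R)
  (X : {RV P >-> d.-tuple R}) (Y eps : {RV P >-> R})
  (Xs : 'I_n -> {RV P >-> d.-tuple R}) (Ys : 'I_n -> {RV P >-> R}).
Hypotheses (sigma0 : 0 < sigma) (Q0 : 0 < Q) (n0 : (0 < n)%N)
  (model : regression_model f0 sigma b X Y eps Xs Ys).

Let mf0 : measurable_fun setT f0 := model_f0 model.

(** The model attaches [eps] to the generic pair only, so expectations over an observation are
    transported there. *)
Lemma sample_expectation (i : 'I_n) (h : d.-tuple R * R -> R) :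
  measurable_fun setT h -> (forall z, 0 <= h z) ->
  (\int[P]_w (h (Xs i w, Ys i w))%:E =
   \int[P]_w (h (X w, f0 (X w) + sigma * eps w))%:E)%E.
Proof.
move=> mh h0.
have m1 : measurable_fun setT (fun w => (Xs i w, Ys i w)).
  exact: measurable_fun_pair.
have m2 : measurable_fun setT (fun w => (X w, Y w)).
  exact: measurable_fun_pair.
have m3 : measurable_fun setT (fun w => (X w, f0 (X w) + sigma * eps w)).
  apply: measurable_fun_pair => //; apply: measurable_funD.
    exact: measurableT_comp.
  exact: measurable_funM.
transitivity (\int[P]_w (h (X w, Y w))%:E)%E.
  apply: (@eq_expectation_identical_law _ _ _ _ _ _
    (fun w => (Xs i w, Ys i w)) (fun w => (X w, Y w))) => // A mA.
  exact: ((model_iid model).2 (Some i) None A mA).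
apply: ge0_ae_eq_integral => //.
- by apply/measurable_EFinP; exact: (measurableT_comp mh m2).
- by apply/measurable_EFinP; exact: (measurableT_comp mh m3).
- by move=> w _; rewrite lee_fin.
- by move=> w _; rewrite lee_fin.
- by apply: filterS (model_eq model) => w -> _.
Qed.

Lemma le_sample_expectation_prod (h : d.-tuple R * R -> R) :
  measurable_fun setT h -> (forall z, 0 <= h z) ->
  (\int[P]_w (h (X w, f0 (X w) + sigma * eps w))%:E <= 1)%E ->
  (\int[P]_w (\prod_(i < n) h (Xs i w, Ys i w))%:E <= 1)%E.
Proof.
move=> mh h0 h1.
pose Z (i : option 'I_n) w :=
  if i is Some j then (Xs j w, Ys j w) else (X w, Y w).
(* Independence also involves the generic pair; the constant factor 1 at [None] removes it from the
   product. *)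
pose H (i : option 'I_n) := if i is Some j then h else fun=> 1.
have := @le_expectation_prod_independent _ _ _ _ _ P _ Z H (fun=> 1).
rewrite big1//; under eq_integral.
  move=> w _; rewrite (bigD1 None)//= mul1r.
  rewrite (reindex_omap Some id)/=; last by case.
  rewrite (eq_bigl xpredT); last by move=> i /=; rewrite eqxx.
  over.
apply.
- case=> [i|]; exact: measurable_fun_pair.
- exact: (model_iid model).1.
- by case=> [i|]; [exact: mh|exact: measurable_cst].
- by case=> [i|] z; [exact: h0|exact: ler01].
- case=> [i|]; first by rewrite sample_expectation.
  by rewrite integral_probability_cst.
Qed.

Context (L : finType) (f : L -> d.-tuple R -> R) (temp : R).
Hypotheses (L0 : (0 < #|L|)%N) (mf : forall l, measurable_fun setT (f l))
  (fQ : forall l, (supnorm (f l \- f0)%R <= Q%:E)%E) (temp0 : 0 < temp).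

Let mg l : measurable_fun setT (f l \- f0).
Proof. exact: measurable_funB. Qed.

(** The sup norm is taken over the cube, where [X] lies almost surely. *)
Let gQ l : {ae P, forall w, `|(f l \- f0) (X w)| <= Q}.
Proof.
apply: filterS (model_cube model) => w cw.
rewrite -lee_fin; apply: le_trans (fQ l).
by apply: ereal_sup_ubound; exists (X w).
Qed.

Let mX2 l : measurable_fun setT (fun w => (f l \- f0) (X w) ^+ 2).
Proof. by apply: measurable_funX; exact: (measurableT_comp (mg l)). Qed.

Let G l : R := fine (sqnormL2 (distribution P X) (f l \- f0)).

Lemma sqnormL2_distribution l : sqnormL2 (distribution P X) (f l \- f0) =
  (\int[P]_w ((f l \- f0) (X w) ^+ 2)%:E)%E.
Proof.
rewrite /sqnormL2 ge0_integral_distribution//.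
  by apply/measurable_EFinP; apply: measurable_funX; exact: mg.
by move=> x; rewrite lee_fin sqr_ge0.
Qed.

Lemma sqnormL2_le l :
  (sqnormL2 (distribution P X) (f l \- f0)%R <= (Q ^+ 2)%:E)%E.
Proof.
rewrite sqnormL2_distribution -(integral_probability_cst P).
apply: ae_ge0_le_integral => //.
- by move=> w _; rewrite lee_fin sqr_ge0.
- exact/measurable_EFinP.
- by move=> w _; rewrite lee_fin sqr_ge0.
apply: filterS (gQ l) => w gw _; rewrite lee_fin.
by rewrite -[X in X <= _]ger0_norm ?sqr_ge0// normrX ler_sqr ?nnegrE// ltW.
Qed.

Let sqG l : sqnormL2 (distribution P X) (f l \- f0) = (G l)%:E.
Proof.
rewrite /G fineK// ge0_fin_numE.
  exact: le_lt_trans (sqnormL2_le l) (ltry _).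
by apply: integral_ge0 => x _; rewrite lee_fin sqr_ge0.
Qed.

Let gG l : (\int[P]_w ((f l \- f0) (X w) ^+ 2)%:E = (G l)%:E)%E.
Proof. by rewrite -sqnormL2_distribution. Qed.

Let risk w := sqnormL2 (distribution P X)
  (aggregate f temp (fun i => Xs i w) (fun i => Ys i w) \- f0).

Let risk_ge0 w : (0 <= risk w)%E.
Proof. by apply: integral_ge0 => x _; rewrite lee_fin sqr_ge0. Qed.

Lemma aggregate_risk_le_bound :
  (\int[P]_w sqnormL2 (distribution P X)
      (aggregate f temp (fun i => Xs i w) (fun i => Ys i w) \- f0)%R
   <= (Q ^+ 2)%:E)%E.
Proof.
rewrite -(integral_probability_cst P).
apply: ge0_le_integral_nonmeasurable => w; first exact: risk_ge0.
have := aggregate_sqnormL2_le temp (Xs^~ w) (Ys^~ w) L0 mg sqG.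
move=> /le_trans; apply; rewrite lee_fin.
set u := fun l : L => _ / temp.
rewrite -[leRHS]mul1r -(sum_gibbs L0 u) mulr_suml; apply: ler_sum => l _.
by rewrite ler_wpM2l ?gibbs_ge0// -lee_fin -sqG sqnormL2_le.
Qed.

Variables (c alpha s : R) (l0 : L).
Hypotheses (c0 : 0 < c) (alpha0 : 0 < alpha) (s0 : 0 < s).
Let lam := 1 + alpha.
Let K := 8 * expR (2 * b ^+ 2).

(** In expectation the three sums of [aggregate_oracle] are at most lam G, (lam / s)(1 + 4 K s^2
    sigma^2 G) and 1 / (n c). The terms lam / s and 1 / (n c) cancel the subtracted constant, and
    the rest of the second sum enlarges the factor in front of G. *)
Lemma aggregate_risk_oracle :
  2 * s * sigma * Q <= 1 ->
  2 * c * lam * sigma * Q <= 1 ->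
  lam ^+ 2 * c * Q ^+ 2 <= alpha / 2 ->
  4 * K * c * lam ^+ 2 * sigma ^+ 2 <= alpha / 2 ->
  (\int[P]_w sqnormL2 (distribution P X)
      (aggregate f temp (fun i => Xs i w) (fun i => Ys i w) \- f0)%R
   <= (lam * (1 + 4 * K * s * sigma ^+ 2))%:E *
        sqnormL2 (distribution P X) (f l0 \- f0)%R +
      ((lam * temp + c^-1) * (ln #|L|%:R / n%:R))%:E)%E.
Proof.
move=> hs h1 h2 h3.
have lam0 : 0 < lam by rewrite addr_gt0.
have n0' : 0 < n%:R :> R by rewrite ltr0n.
have M0 : 0 < #|L|%:R :> R by rewrite ltr0n.
pose g l := f l \- f0.
pose noise l (z : d.-tuple R * R) := g l z.1 * (z.2 - f0 z.1).
pose hV l (z : d.-tuple R * R) :=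
  expR (c * (G l - lam * (g l z.1 ^+ 2 - 2 * noise l z))).
pose hD (z : d.-tuple R * R) := expR (- 2 * s * noise l0 z).
have mg1 l : measurable_fun setT (fun z : d.-tuple R * R => g l z.1).
  exact: (measurableT_comp (mg l)).
have mnoise l : measurable_fun setT (noise l).
  apply: measurable_funM => //; apply: measurable_funB => //.
  exact: (measurableT_comp mf0).
have mhV l : measurable_fun setT (hV l).
  apply: measurableT_comp => //; apply: measurable_funM => //.
  apply: measurable_funB => //; apply: measurable_funM => //.
  apply: measurable_funB; first exact: measurable_funX.
  exact: measurable_funM.
have mhD : measurable_fun setT hD.
  by apply: measurableT_comp => //; exact: measurable_funM.
have mZ i : measurable_fun setT (fun w => (Xs i w, Ys i w)).
  exact: measurable_fun_pair.
have noiseE l w : noise l (X w, f0 (X w) + sigma * eps w) =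
    g l (X w) * (sigma * eps w).
  by rewrite /noise /=; congr (_ * _); ring.
have EV l : (\int[P]_w (\prod_(i < n) hV l (Xs i w, Ys i w))%:E <= 1)%E.
  apply: le_sample_expectation_prod => //; first by move=> z; exact: expR_ge0.
  under eq_integral do rewrite /hV noiseE /=.
  exact: (excess_loss_mgf (model_symmetric model) (model_subgaussian model)
    sigma0 Q0 (mg l) (gQ l) (gG l) c0 alpha0).
have ED i : (\int[P]_w (hD (Xs i w, Ys i w))%:E <=
    (1 + 4 * K * s ^+ 2 * sigma ^+ 2 * G l0)%:E)%E.
  rewrite sample_expectation//; last by move=> z; exact: expR_ge0.
  under eq_integral do rewrite /hD noiseE.
  exact: (excess_loss_noise_mgf (model_symmetric model)
    (model_subgaussian model) sigma0 (mg l0) (gQ l0) (gG l0) s0).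
have EG i : (\int[P]_w (g l0 (Xs i w) ^+ 2)%:E <= (G l0)%:E)%E.
  have := @sample_expectation i (fun z => g l0 z.1 ^+ 2).
  move=> ->; first by rewrite gG.
  - exact: measurable_funX.
  - by move=> z; rewrite sqr_ge0.
pose k0 := lam / s + (n%:R * c)^-1.
pose B := (lam * temp + c^-1) * (ln #|L|%:R / n%:R).
pose F1 w := lam / n%:R * \sum_(i < n) g l0 (Xs i w) ^+ 2.
pose F2 w := lam / (n%:R * s) * \sum_(i < n) hD (Xs i w, Ys i w).
pose F3 w := (n%:R * c * #|L|%:R)^-1 *
  \sum_l \prod_(i < n) hV l (Xs i w, Ys i w).
have mg2 i : measurable_fun setT (fun w => g l0 (Xs i w) ^+ 2).
  by apply: measurable_funX; exact: (measurableT_comp (mg l0)).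
have mD i : measurable_fun setT (fun w => hD (Xs i w, Ys i w)).
  exact: (measurableT_comp mhD).
have mV l : measurable_fun setT (fun w => \prod_(i < n) hV l (Xs i w, Ys i w)).
  by apply: measurable_prod => i _; exact: (measurableT_comp (mhV l)).
have V0 l w : 0 <= \prod_(i < n) hV l (Xs i w, Ys i w).
  by apply: prodr_ge0 => i _; exact: expR_ge0.
have k1 : 0 <= lam / n%:R by rewrite divr_ge0// ltW.
have k2 : 0 <= lam / (n%:R * s) by rewrite divr_ge0 ?mulr_ge0 ?ltW.
have k3 : 0 <= (n%:R * c * #|L|%:R)^-1 by rewrite invr_ge0 !mulr_ge0 ?ltW.
have mF1 : measurable_fun setT F1.
  by apply: measurable_funM => //; apply: measurable_sum.
have mF2 : measurable_fun setT F2.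
  by apply: measurable_funM => //; apply: measurable_sum.
have mF3 : measurable_fun setT F3.
  by apply: measurable_funM => //; apply: measurable_sum.
have F10 w : 0 <= F1 w by rewrite mulr_ge0// sumr_ge0// => i _; exact: sqr_ge0.
have F20 w : 0 <= F2 w by rewrite mulr_ge0// sumr_ge0// => i _; exact: expR_ge0.
have F30 w : 0 <= F3 w by rewrite mulr_ge0// sumr_ge0.
have E1 : (\int[P]_w (F1 w)%:E <= (lam * G l0)%:E)%E.
  have := @le_expectation_scale_sum _ _ _ P _ (lam / n%:R)
    (fun i w => g l0 (Xs i w) ^+ 2) (fun=> G l0) k1 mg2
    (fun i w => sqr_ge0 _) EG.
  rewrite sumr_const card_ord -[G l0 *+ n]mulr_natl.
  by rewrite (_ : lam / n%:R * _ = lam * G l0)//; field; rewrite gt_eqF.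
have E2 : (\int[P]_w (F2 w)%:E <=
    (lam / s * (1 + 4 * K * s ^+ 2 * sigma ^+ 2 * G l0))%:E)%E.
  have := @le_expectation_scale_sum _ _ _ P _ (lam / (n%:R * s))
    (fun i w => hD (Xs i w, Ys i w)) (fun=> _) k2 mD
    (fun i w => expR_ge0 _) ED.
  set m := 1 + _; rewrite sumr_const card_ord -[m *+ n]mulr_natl.
  rewrite (_ : lam / (n%:R * s) * _ = lam / s * m)//.
  by field; rewrite !gt_eqF.
have E3 : (\int[P]_w (F3 w)%:E <= ((n%:R * c)^-1)%:E)%E.
  have := @le_expectation_scale_sum _ _ _ P _ (n%:R * c * #|L|%:R)^-1
    (fun l w => \prod_(i < n) hV l (Xs i w, Ys i w)) (fun=> 1) k3 mV V0 EV.
  rewrite sumr_const.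
  rewrite (_ : (n%:R * c * #|L|%:R)^-1 * _ = (n%:R * c)^-1)//.
  by field; rewrite !gt_eqF.
have rle w : (risk w <= (F1 w + F2 w + F3 w + B - k0)%:E)%E.
  have := aggregate_sqnormL2_le temp (Xs^~ w) (Ys^~ w) L0 mg sqG.
  move=> /le_trans; apply; rewrite lee_fin.
  exact: (@aggregate_oracle _ _ _ _ f temp (fun i => Xs i w) (fun i => Ys i w)
    f0 n0 L0 G c lam s l0).
(* The bound is nonnegative despite the subtraction, because it dominates the risk. *)
have H0 w : 0 <= F1 w + F2 w + F3 w + B - k0.
  by rewrite -lee_fin (le_trans _ (rle w)).
have lnM0 : 0 <= ln #|L|%:R :> R by rewrite ln_ge0// ler1n.
have B0 : 0 <= B.
  apply: mulr_ge0; last exact: divr_ge0.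
  by rewrite addr_ge0 ?invr_ge0 ?(ltW c0)// mulr_ge0 ?ltW.
have k00 : 0 <= k0 by rewrite addr_ge0 ?divr_ge0 ?invr_ge0 ?mulr_ge0// ltW.
have mF : measurable_fun setT (fun w => F1 w + F2 w + F3 w + B).
  by do 3 apply: measurable_funD => //.
apply: (le_trans (ge0_le_integral_nonmeasurable P risk_ge0 rle)).
(* Adding [k0] back leaves only nonnegative integrands, for which additivity holds without
   integrability. *)
have : (\int[P]_w (F1 w + F2 w + F3 w + B - k0)%:E + k0%:E <=
    (lam * G l0 + lam / s * (1 + 4 * K * s ^+ 2 * sigma ^+ 2 * G l0) +
     (n%:R * c)^-1 + B)%:E)%E.
  rewrite -(integral_probability_cst P k0) -ge0_integralD//; last 2 first.
  - by move=> w _; rewrite lee_fin.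
  - by apply/measurable_EFinP; exact: measurable_funB.
  under eq_integral do rewrite -EFinD subrK.
  apply: le_expectation_add => //.
  - by do 2 apply: measurable_funD => //.
  - by move=> w; rewrite !addr_ge0.
  - apply: le_expectation_add => //.
    + exact: measurable_funD.
    + by move=> w; rewrite !addr_ge0.
    + exact: le_expectation_add.
  - by rewrite integral_probability_cst.
rewrite -leeBrDr// => /le_trans; apply.
rewrite sqG -EFinM -EFinB -EFinD lee_fin -/B le_eqVlt; apply/orP; left.
by apply/eqP; rewrite /k0; field; rewrite !gt_eqF.
Qed.

End Model.

(** * Choice of the constants and conclusion *)

Lemma invr_add_mul_le1 (R : realFieldType) (x y : R) :
  0 < x -> 0 <= y -> (x + y)^-1 * x <= 1.
Proof.
move=> x0 y0; rewrite mulrC ler_pdivrMr ?mul1r ?lerDl//.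
by rewrite ltr_pwDl.
Qed.

Theorem theorem4 (R : realType) (a Q sigma b : R)
    (ha : 0 < a) (hQ : 0 < Q) (hsigma : 0 < sigma) (hb : 0 < b) :
  exists C : R, 0 < C /\
  forall (d n : nat) (disp : measure_display) (Omega : measurableType disp)
    (P : probability Omega R) (f0 : d.-tuple R -> R)
    (X : {RV P >-> d.-tuple R}) (Y eps : {RV P >-> R})
    (Xs : 'I_n -> {RV P >-> d.-tuple R}) (Ys : 'I_n -> {RV P >-> R})
    (L : finType) (f : L -> d.-tuple R -> R) (T : R),
  (1 < n)%N ->
  regression_model f0 sigma b X Y eps Xs Ys ->
  (0 < #|L|)%N ->
  injective f ->
  (forall l : L, measurable_fun setT (f l)) ->
  (forall l : L, (supnorm (f l \- f0)%R <= Q%:E)%E) ->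
  0 < T ->
  (\int[P]_w sqnormL2 (distribution P X)
      (aggregate f T (fun i => Xs i w) (fun i => Ys i w) \- f0)%R
   <= (1 + a)%:E *
        \big[mine/+oo]_(l : L) sqnormL2 (distribution P X) (f l \- f0)%R
      + ((C + T) * (Num.sqrt (ln n%:R) * ln #|L|%:R / n%:R))%:E)%E.
Proof.
(* The slack [a] is shared between the maximum ([alpha]) and the noise of the competitor ([beta]
   below): lam (1 + beta) = 1 + 2 alpha = 1 + a. *)
pose alpha := a / 2; pose lam := 1 + alpha; pose K := 8 * expR (2 * b ^+ 2).
have al0 : 0 < alpha by rewrite divr_gt0.
have lam1 : 1 <= lam by rewrite lerDl ltW.
have lam0 : 0 < lam by apply: lt_le_trans lam1.
have K0 : 0 < K by rewrite mulr_gt0// expR_gt0.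
pose beta := alpha / lam.
have be0 : 0 < beta by rewrite divr_gt0.
(* Each smallness condition on [s] reads s s_i <= 1; the inverse of the sum of the s_i meets
   both. *)
pose s1 := 2 * sigma * Q; pose s2 := 4 * K * sigma ^+ 2 / beta.
have s10 : 0 < s1 by rewrite !mulr_gt0.
have s20 : 0 < s2 by rewrite divr_gt0// mulr_gt0 ?exprn_gt0// mulr_gt0.
pose s := (s1 + s2)^-1.
have s0 : 0 < s by rewrite invr_gt0 addr_gt0.
have hs : 2 * s * sigma * Q <= 1.
  by have := invr_add_mul_le1 s10 (ltW s20); rewrite -/s /s1; lra.
have hs2 : 4 * K * s * sigma ^+ 2 <= beta.
  have := invr_add_mul_le1 s20 (ltW s10); rewrite addrC -/s.
  by rewrite /s2 mulrA ler_pdivrMr// mul1r; lra.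
(* In the same way, [c1], [c2] and [c3] encode the three conditions of [excess_loss_mgf]. *)
pose c1 := 2 * lam * sigma * Q; pose c2 := 2 * lam ^+ 2 * Q ^+ 2 / alpha.
pose c3 := 8 * K * lam ^+ 2 * sigma ^+ 2 / alpha.
have c10 : 0 < c1 by rewrite !mulr_gt0.
have c20 : 0 < c2.
  by rewrite divr_gt0// mulr_gt0 ?exprn_gt0// mulr_gt0 ?exprn_gt0.
have c30 : 0 < c3.
  by rewrite divr_gt0// mulr_gt0 ?exprn_gt0// mulr_gt0 ?exprn_gt0// mulr_gt0.
pose c := (c1 + c2 + c3)^-1.
have c0 : 0 < c by rewrite invr_gt0 !addr_gt0.
have h1 : 2 * c * lam * sigma * Q <= 1.
  have := invr_add_mul_le1 c10 (ltW (addr_gt0 c20 c30)); rewrite addrA -/c /c1.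
  lra.
have h2 : lam ^+ 2 * c * Q ^+ 2 <= alpha / 2.
  have := invr_add_mul_le1 c20 (ltW (addr_gt0 c10 c30)).
  rewrite addrA (addrC c2) -/c /c2 mulrA ler_pdivrMr// mul1r; lra.
have h3 : 4 * K * c * lam ^+ 2 * sigma ^+ 2 <= alpha / 2.
  have := invr_add_mul_le1 c30 (ltW (addr_gt0 c10 c20)).
  rewrite addrC -/c /c3 mulrA ler_pdivrMr// mul1r; lra.
have ln20 : 0 < ln 2 :> R by rewrite ln_gt0// ltr1n.
have q0 : 0 < Num.sqrt (ln 2) :> R by rewrite sqrtr_gt0.
(* From [N0] on, sqrt(ln n) >= lam. Below it, with at least two functions, sqrt(ln n) ln M / n >=
   sqrt(ln 2) ln 2 / N0, and [C2] times this lower bound is Q^2. *)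
pose N0 := expR (lam ^+ 2).
pose C2 := Q ^+ 2 * N0 / (Num.sqrt (ln 2) * ln 2).
have C20 : 0 < C2.
  by rewrite divr_gt0 ?mulr_gt0 ?exprn_gt0 ?expR_gt0.
have ic0 : 0 < c^-1 by rewrite invr_gt0.
exists (c^-1 + C2); split; first exact: addr_gt0.
move=> d n disp Omega P f0 X Y eps Xs Ys L f T n1 model L0 _ mf fQ T0.
have n0 : (0 < n)%N by exact: ltnW.
have n0' : 0 < n%:R :> R by rewrite ltr0n.
have [l _] := card_gt0P L0.
have [l0 _ ->] := @eq_bigmin _ _ _ +oo%E l xpredT
  (fun l => sqnormL2 (distribution P X) (f l \- f0)) isT (fun k _ => leey _).
set S := sqnormL2 _ (f l0 \- f0).
have S0 : (0 <= S)%E by apply: integral_ge0 => x _; rewrite lee_fin sqr_ge0.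
have lnn0 : 0 <= ln n%:R :> R by rewrite ln_ge0// ler1n.
have lnM0 : 0 <= ln #|L|%:R :> R by rewrite ln_ge0// ler1n.
set D := _ * (_ / _ : R).
suff [H|H] : (lam * T + c^-1) * (ln #|L|%:R / n%:R) <= D \/ Q ^+ 2 <= D.
- apply: (le_trans (aggregate_risk_oracle hsigma hQ n0 model L0 mf fQ T0 l0
    c0 al0 s0 hs h1 h2 h3)).
  rewrite leeD ?lee_fin// lee_wpmul2r// lee_fin.
  have -> : 1 + a = lam * (1 + beta).
    by rewrite /beta /lam /alpha; field; rewrite gt_eqF// -/alpha -/lam; lra.
  by rewrite ler_wpM2l ?(ltW lam0)// lerD2l.
- apply: (le_trans (aggregate_risk_le_bound hQ model T L0 mf fQ)).
  apply: (@le_trans _ _ D%:E); first by rewrite lee_fin.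
  by rewrite leeDr// mule_ge0// lee_fin addr_ge0// ltW.
(* A single function is set apart: [D] vanishes, so the trivial bound is of no help, but so does the
   remainder of the oracle inequality, for every [n]. *)
have [M1|M2] := leqP #|L| 1.
  left; rewrite /D; have -> : #|L| = 1%N by apply/eqP; rewrite eqn_leq M1.
  by rewrite ln1 mulr0 !mul0r !mulr0.
have [nN|nN] := leP N0 n%:R.
  left; have lamn : lam <= Num.sqrt (ln n%:R).
    rewrite -[leLHS]ger0_norm ?(ltW lam0)// -sqrtr_sqr ler_wsqrtr//.
    by rewrite -ler_expR lnK ?posrE.
  rewrite /D [leRHS](_ : _ = (c^-1 + C2 + T) * Num.sqrt (ln n%:R) *
    (ln #|L|%:R / n%:R)); last by ring.
  rewrite ler_wpM2r ?divr_ge0//.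
  have sq1 : 1 <= Num.sqrt (ln n%:R) :> R by exact: le_trans lam1 lamn.
  have hT : lam * T <= T * Num.sqrt (ln n%:R) by rewrite mulrC ler_pM2l.
  have hc : c^-1 <= c^-1 * Num.sqrt (ln n%:R) by rewrite ler_peMr// ltW.
  have hC : 0 <= C2 * Num.sqrt (ln n%:R) by rewrite mulr_ge0 ?sqrtr_ge0// ltW.
  lra.
right; rewrite /D.
have qn : Num.sqrt (ln 2) <= Num.sqrt (ln n%:R) :> R.
  by rewrite ler_wsqrtr// ler_ln ?posrE// ler_nat.
have qM : ln 2 <= ln #|L|%:R :> R by rewrite ler_ln ?posrE ?ltr0n// ler_nat.
apply: (@le_trans _ _ (C2 * (Num.sqrt (ln 2) * ln 2 / N0))).
  rewrite /C2 le_eqVlt; apply/orP; left; apply/eqP; field.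
  by rewrite !gt_eqF ?expR_gt0.
apply: ler_pM.
- exact: ltW.
- by rewrite divr_ge0 ?expR_ge0// mulr_ge0// ltW.
- by rewrite addrAC lerDr addr_ge0// ltW.
apply: ler_pM.
- by rewrite mulr_ge0// ltW.
- by rewrite invr_ge0 expR_ge0.
- by apply: ler_pM => //; exact: ltW.
- by rewrite lef_pV2 ?posrE ?expR_gt0// ltW.
Qed.
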